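(* Let $\mathcal{X}$ and $\mathcal{C}$ be skew monoidal categories and let there be a weak action of $\mathcal{X}$ on $\mathcal{C}$. Then the semidirect product $\mathcal{X} \ltimes \mathcal{C}$, with unit $\mathcal{I} = \langle \mathcal{I}_{\mathcal{X}}, \mathcal{I}_{\mathcal{C}} \rangle$, satisfies the three triangle identities: for all objects $P, Q$ of $\mathcal{X} \ltimes \mathcal{C}$, \[ \alpha_{\mathcal{I},P,Q} \circ \lambda_{P \otimes Q} = \lambda_P \otimes Q, \] \[ (\rho_P \otimes Q) \circ \alpha_{P,\mathcal{I},Q} \circ (P \otimes \lambda_Q) = \mathrm{id}_{P \otimes Q}, \] \[ \rho_{P \otimes Q} \circ \alpha_{P,Q,\mathcal{I}} = P \otimes \rho_Q. \]
   Context: An object's name also denotes its identity morphism. Skew monoidal category: a category with a functor $\otimes$ in two variables, an object $\mathcal{I}$, and natural transformations (not necessarily invertible) $\alpha_{A,B,C} \colon A \otimes (B \otimes C) \to (A \otimes B) \otimes C$, $\lambda_A \colon A \to \mathcal{I} \otimes A$, $\rho_A \colon A \otimes \mathcal{I} \to A$ satisfying: the pentagon identity $\alpha_{A \otimes B, C, D} \circ \alpha_{A, B, C \otimes D} = (\alpha_{A,B,C} \otimes D) \circ \alpha_{A, B \otimes C, D} \circ (A \otimes \alpha_{B,C,D})$; the three triangle identities $\alpha_{\mathcal{I},A,B} \circ \lambda_{A \otimes B} = \lambda_A \otimes B$, $(\rho_A \otimes B) \circ \alpha_{A,\mathcal{I},B} \circ (A \otimes \lambda_B) = \mathrm{id}_{A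 \otimes B}$, $\rho_{A \otimes B} \circ \alpha_{A,B,\mathcal{I}} = A \otimes \rho_B$; and the unitor identity $\rho_{\mathcal{I}} \circ \lambda_{\mathcal{I}} = \mathrm{id}_{\mathcal{I}}$. Weak action of $\mathcal{X}$ on $\mathcal{C}$: an oplax monoidal functor $\Gamma$ from $\mathcal{X}$ to the strict monoidal category of lax monoidal endofunctors of $\mathcal{C}$ and monoidal natural transformations, with tensor product given by composition in diagrammatic order. Explicitly: (1) for each object $X$ of $\mathcal{X}$, a functor $(-)^X \colon \mathcal{C} \to \mathcal{C}$ with a natural transformation $\varphi^X_{B,C} \colon B^X \otimes C^X \to (B \otimes C)^X$ and a morphism $\varphi^X \colon \mathcal{I}_{\mathcal{C}} \to \mathcal{I}_{\mathcal{C}}^X$ such that $(\alpha_{A,B,C})^X \circ \varphi^X_{A,B \otimes C} \circ (A^X \otimes \varphi^X_{B,C}) = \varphi^X_{A \otimes B, C} \circ (\varphi^X_{A,B} \otimes C^X) \circ \alpha_{A^X,B^X,C^X}$, $\varphi^X_{\mathcal{I}_{\mathcal{C}},C} \circ (\varphi^X \otimes C^X) \circ \lambda_{C^X} = (\lambda_C)^X$, and $(\rho_C)^X \circ \varphi^X_{C,\mathcal{I}_{\mathcal{C}}} \circ (C^X \otimes \varphi^X) = \rho_{C^X}$; (2) for each $f \colon X \to Y$ in $\mathcal{X}$, functorially in $f$, a natural transformation $(-)^f \colon (-)^X \to (-)^Y$ with $\varphi^Y_{B,C} \circ (B^f \otimes C^f) = (B \otimes C)^f \circ \varphi^X_{B,C}$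 and $\mathcal{I}_{\mathcal{C}}^f \circ \varphi^X = \varphi^Y$; (3) morphisms $\psi^{X,Y}_C \colon C^{X \otimes Y} \to (C^X)^Y$, natural in $X, Y, C$, and $\psi_C \colon C^{\mathcal{I}_{\mathcal{X}}} \to C$, natural in $C$, such that $(\psi^{X,Y}_C)^Z \circ \psi^{X \otimes Y,Z}_C \circ C^{\alpha_{X,Y,Z}} = \psi^{Y,Z}_{C^X} \circ \psi^{X,Y \otimes Z}_C$, $(\psi_C)^X \circ \psi^{\mathcal{I}_{\mathcal{X}},X}_C \circ C^{\lambda_X} = \mathrm{id}_{C^X}$, and $\psi_{C^X} \circ \psi^{X,\mathcal{I}_{\mathcal{X}}}_C = C^{\rho_X}$; (4) these are monoidal natural transformations: $\psi^{X,Y}_{B \otimes C} \circ \varphi^{X \otimes Y}_{B,C} = (\varphi^X_{B,C})^Y \circ \varphi^Y_{B^X,C^X} \circ (\psi^{X,Y}_B \otimes \psi^{X,Y}_C)$, $\psi^{X,Y}_{\mathcal{I}_{\mathcal{C}}} \circ \varphi^{X \otimes Y} = (\varphi^X)^Y \circ \varphi^Y$, $\psi_{B \otimes C} \circ \varphi^{\mathcal{I}_{\mathcal{X}}}_{B,C} = \psi_B \otimes \psi_C$, and $\psi_{\mathcal{I}_{\mathcal{C}}} \circ \varphi^{\mathcal{I}_{\mathcal{X}}} = \mathrm{id}_{\mathcal{I}_{\mathcal{C}}}$. Semidirect product $\mathcal{X} \ltimes \mathcal{C}$: the underlying category is $\mathcal{X} \times \mathcal{C}$, with objects written $\langle X,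 C \rangle$. The tensor product is $\langle X, B \rangle \otimes \langle Y, C \rangle = \langle X \otimes Y, B^Y \otimes C \rangle$ (and correspondingly on morphisms) and the unit is $\langle \mathcal{I}_{\mathcal{X}}, \mathcal{I}_{\mathcal{C}} \rangle$. The structure maps are given by their components in $\mathcal{X}$ and in $\mathcal{C}$. Their $\mathcal{X}$-components are the structure maps $\alpha_{X,Y,Z}$, $\lambda_X$, $\rho_X$ of $\mathcal{X}$. Their $\mathcal{C}$-components are: for $\alpha_{\langle X,A \rangle, \langle Y,B \rangle, \langle Z,C \rangle}$, the composite $(\varphi^Z_{A^Y,B} \otimes C) \circ \alpha_{(A^Y)^Z,B^Z,C} \circ (\psi^{Y,Z}_A \otimes (B^Z \otimes C)) \colon A^{Y \otimes Z} \otimes (B^Z \otimes C) \to (A^Y \otimes B)^Z \otimes C$; for $\lambda_{\langle X,C \rangle}$, the composite $(\varphi^X \otimes C) \circ \lambda_C \colon C \to \mathcal{I}_{\mathcal{C}}^X \otimes C$; for $\rho_{\langle X,C \rangle}$, the composite $\rho_C \circ (\psi_C \otimes \mathcal{I}_{\mathcal{C}}) \colon C^{\mathcal{I}_{\mathcal{X}}} \otimes \mathcal{I}_{\mathcal{C}} \to C$. *)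

(* Defs.v *)
Set Implicit Arguments.
Unset Strict Implicit.
Unset Printing Implicit Defensive.

Declare Scope skew_scope.
Open Scope skew_scope.

Record category := Category {
  obj :> Type;
  hom : obj -> obj -> Type;
  idm : forall a, hom a a;
  comp : forall a b c, hom b c -> hom a b -> hom a c;
  comp_idl : forall a b (f : hom a b), comp (idm b) f = f;
  comp_idr : forall a b (f : hom a b), comp f (idm a) = f;
  comp_assoc : forall a b c d (h : hom c d) (g : hom b c) (f : hom a b),
    comp h (comp g f) = comp (comp h g) f
}.
Arguments hom {c} _ _ : rename.
Arguments idm {c} _ : rename.

Notation "g ∘ f" := (comp g f) (at level 45, left associativity) : skew_scope.

Record functor (C D : category) := Functor {
  fobj :> C -> D;
  fmap : forall a b, hom a b -> hom (fobj a) (fobj b);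
  fmap_id : forall a, fmap (idm a) = idm (fobj a);
  fmap_comp : forall a b c (g : hom b c) (f : hom a b),
    fmap (g ∘ f) = fmap g ∘ fmap f
}.
Arguments fmap {C D} _ {a b} _.

Lemma pair_eq (A B : Type) (p q : A * B) :
  fst p = fst q -> snd p = snd q -> p = q.
Proof. destruct p, q; simpl; congruence. Qed.

Definition prod_cat (C D : category) : category.
Proof.
refine (@Category (C * D)%type
  (fun p q => (hom (fst p) (fst q) * hom (snd p) (snd q))%type)
  (fun p => (idm (fst p), idm (snd p)))
  (fun p q r g f => (fst g ∘ fst f, snd g ∘ snd f)) _ _ _);
  intros; apply pair_eq; simpl;
  (apply comp_idl || apply comp_idr || apply comp_assoc).
Defined.

(** The data of a skew monoidal category, including functoriality of the
    tensor and naturality of the structure maps, but not the five coherence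
    identities. *)
Record skew_data := SkewData {
  base :> category;
  tens : functor (prod_cat base base) base;
  unit : base;
  tens_obj (a b : base) : base := tens (a, b);
  tens_hom (a b a' b' : base) (f : hom a a') (g : hom b b')
    : hom (tens_obj a b) (tens_obj a' b') :=
    @fmap _ _ tens (a, b) (a', b') (f, g);
  alpha : forall a b c,
    hom (tens_obj a (tens_obj b c)) (tens_obj (tens_obj a b) c);
  lambda : forall a, hom a (tens_obj unit a);
  rho : forall a, hom (tens_obj a unit) a;
  alpha_nat : forall a b c a' b' c'
      (f : hom a a') (g : hom b b') (h : hom c c'),
    tens_hom (tens_hom f g) h ∘ alpha a b c
    = alpha a' b' c' ∘ tens_hom f (tens_hom g h);
  lambda_nat : forall a a' (f : hom a a'),
    tens_hom (idm unit) f ∘ lambda a = lambda a' ∘ f;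
  rho_nat : forall a a' (f : hom a a'),
    f ∘ rho a = rho a' ∘ tens_hom f (idm unit)
}.
Arguments unit {s} : rename.
Arguments tens_obj {s} _ _ : rename.
Arguments tens_hom {s a b a' b'} _ _ : rename.
Arguments alpha {s} _ _ _ : rename.
Arguments lambda {s} _ : rename.
Arguments rho {s} _ : rename.

Notation "a ⊗ b" := (tens_obj a b) (at level 40, left associativity)
  : skew_scope.
Notation "f ⊗₁ g" := (tens_hom f g) (at level 40, left associativity)
  : skew_scope.

Record skew_axioms (M : skew_data) : Prop := SkewAxioms {
  pentagon : forall a b c d : M,
    alpha (a ⊗ b) c d ∘ alpha a b (c ⊗ d)
    = (alpha a b c ⊗₁ idm d) ∘ alpha a (b ⊗ c) d ∘ (idm a ⊗₁ alpha b c d);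
  triangle_l : forall a b : M,
    alpha unit a b ∘ lambda (a ⊗ b) = lambda a ⊗₁ idm b;
  triangle_m : forall a b : M,
    (rho a ⊗₁ idm b) ∘ alpha a unit b ∘ (idm a ⊗₁ lambda b) = idm (a ⊗ b);
  triangle_r : forall a b : M,
    rho (a ⊗ b) ∘ alpha a b unit = idm a ⊗₁ rho b;
  unitor : rho (@unit M) ∘ lambda unit = idm unit
}.

Record skew_monoidal := SkewMonoidal {
  skew_data_of :> skew_data;
  skew_axioms_of : skew_axioms skew_data_of
}.

(** [act x c] is c^x, [fmap (act x) h] is h^x and [act_hom f c] is c^f. *)
Record weak_action (X C : skew_monoidal) := WeakAction {
  (* lax monoidal endofunctors *)
  act :> forall x : X, functor C C;
  phi : forall (x : X) (b c : C), hom (act x b ⊗ act x c) (act x (b ⊗ c));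
  phi0 : forall x : X, hom unit (act x unit);
  phi_nat : forall (x : X) (b c b' c' : C) (g : hom b b') (h : hom c c'),
    fmap (act x) (g ⊗₁ h) ∘ phi x b c
    = phi x b' c' ∘ (fmap (act x) g ⊗₁ fmap (act x) h);
  phi_alpha : forall (x : X) (a b c : C),
    fmap (act x) (alpha a b c) ∘ phi x a (b ⊗ c)
      ∘ (idm (act x a) ⊗₁ phi x b c)
    = phi x (a ⊗ b) c ∘ (phi x a b ⊗₁ idm (act x c))
      ∘ alpha (act x a) (act x b) (act x c);
  phi_lambda : forall (x : X) (c : C),
    phi x unit c ∘ (phi0 x ⊗₁ idm (act x c)) ∘ lambda (act x c)
    = fmap (act x) (lambda c);
  phi_rho : forall (x : X) (c : C),
    fmap (act x) (rho c) ∘ phi x c unit ∘ (idm (act x c) ⊗₁ phi0 x)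
    = rho (act x c);

  (* monoidal natural transformations, functorial in f *)
  act_hom : forall (x y : X) (f : hom x y) (c : C), hom (act x c) (act y c);
  act_hom_nat : forall (x y : X) (f : hom x y) (c c' : C) (h : hom c c'),
    fmap (act y) h ∘ act_hom f c = act_hom f c' ∘ fmap (act x) h;
  act_hom_id : forall (x : X) (c : C), act_hom (idm x) c = idm (act x c);
  act_hom_comp : forall (x y z : X) (g : hom y z) (f : hom x y) (c : C),
    act_hom (g ∘ f) c = act_hom g c ∘ act_hom f c;
  act_hom_phi : forall (x y : X) (f : hom x y) (b c : C),
    phi y b c ∘ (act_hom f b ⊗₁ act_hom f c)
    = act_hom f (b ⊗ c) ∘ phi x b c;
  act_hom_phi0 : forall (x y : X) (f : hom x y),
    act_hom f unit ∘ phi0 x = phi0 y;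

  (* oplax structure *)
  psi : forall (x y : X) (c : C), hom (act (x ⊗ y) c) (act y (act x c));
  psi0 : forall c : C, hom (act unit c) c;
  psi_nat_exp : forall (x y x' y' : X) (f : hom x x') (g : hom y y') (c : C),
    fmap (act y') (act_hom f c) ∘ act_hom g (act x c) ∘ psi x y c
    = psi x' y' c ∘ act_hom (f ⊗₁ g) c;
  psi_nat : forall (x y : X) (c c' : C) (h : hom c c'),
    fmap (act y) (fmap (act x) h) ∘ psi x y c
    = psi x y c' ∘ fmap (act (x ⊗ y)) h;
  psi0_nat : forall (c c' : C) (h : hom c c'),
    h ∘ psi0 c = psi0 c' ∘ fmap (act unit) h;
  psi_alpha : forall (x y z : X) (c : C),
    fmap (act z) (psi x y c) ∘ psi (x ⊗ y) z c ∘ act_hom (alpha x y z) c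
    = psi y z (act x c) ∘ psi x (y ⊗ z) c;
  psi_lambda : forall (x : X) (c : C),
    fmap (act x) (psi0 c) ∘ psi unit x c ∘ act_hom (lambda x) c
    = idm (act x c);
  psi_rho : forall (x : X) (c : C),
    psi0 (act x c) ∘ psi x unit c = act_hom (rho x) c;

  (* monoidality of the oplax structure *)
  psi_phi : forall (x y : X) (b c : C),
    psi x y (b ⊗ c) ∘ phi (x ⊗ y) b c
    = fmap (act y) (phi x b c) ∘ phi y (act x b) (act x c)
      ∘ (psi x y b ⊗₁ psi x y c);
  psi_phi0 : forall x y : X,
    psi x y unit ∘ phi0 (x ⊗ y) = fmap (act y) (phi0 x) ∘ phi0 y;
  psi0_phi : forall b c : C,
    psi0 (b ⊗ c) ∘ phi unit b c = psi0 b ⊗₁ psi0 c;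
  psi0_phi0 : psi0 unit ∘ phi0 unit = idm unit
}.
Arguments phi {X C} _ _ _ _.
Arguments phi0 {X C} _ _.
Arguments act_hom {X C} _ {x y} _ _.
Arguments psi {X C} _ _ _ _.
Arguments psi0 {X C} _ _.

(** h^f : b^x -> b'^y for f : x -> y and h : b -> b'. *)
Definition act_map (X C : skew_monoidal) (G : weak_action X C) (x y : X)
    (b b' : C) (f : hom x y) (h : hom b b') : hom (G x b) (G y b') :=
  fmap (G y) h ∘ act_hom G f b.

Lemma tens_hom_id (M : skew_data) (a b : M) : idm a ⊗₁ idm b = idm (a ⊗ b).
Proof. exact (fmap_id (tens M) (a, b)). Qed.

Lemma tens_hom_comp (M : skew_data) (a b a' b' a'' b'' : M)
    (f' : hom a' a'') (f : hom a a') (g' : hom b' b'') (g : hom b b') :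
  (f' ∘ f) ⊗₁ (g' ∘ g) = (f' ⊗₁ g') ∘ (f ⊗₁ g).
Proof.
exact (@fmap_comp _ _ (tens M) (a, b) (a', b') (a'', b'') (f', g') (f, g)).
Qed.

Lemma act_map_id (X C : skew_monoidal) (G : weak_action X C) (x : X) (b : C) :
  act_map G (idm x) (idm b) = idm (G x b).
Proof. unfold act_map. now rewrite fmap_id, act_hom_id, comp_idl. Qed.

Lemma act_map_comp (X C : skew_monoidal) (G : weak_action X C) (x y z : X)
    (b b' b'' : C) (f' : hom y z) (f : hom x y)
    (h' : hom b' b'') (h : hom b b') :
  act_map G (f' ∘ f) (h' ∘ h) = act_map G f' h' ∘ act_map G f h.
Proof.
unfold act_map. rewrite fmap_comp, act_hom_comp, !comp_assoc. f_equal.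
rewrite <- !comp_assoc. f_equal. apply act_hom_nat.
Qed.

Lemma act_map_phi (X C : skew_monoidal) (G : weak_action X C) (x y : X)
    (f : hom x y) (b c b' c' : C) (g : hom b b') (h : hom c c') :
  act_map G f (g ⊗₁ h) ∘ phi G x b c
  = phi G y b' c' ∘ (act_map G f g ⊗₁ act_map G f h).
Proof.
unfold act_map. rewrite tens_hom_comp, comp_assoc, <- phi_nat.
rewrite <- !comp_assoc. f_equal. symmetry. apply act_hom_phi.
Qed.

Lemma act_map_psi (X C : skew_monoidal) (G : weak_action X C) (x y x' y' : X)
    (f : hom x x') (g : hom y y') (c c' : C) (h : hom c c') :
  act_map G g (act_map G f h) ∘ psi G x y c
  = psi G x' y' c' ∘ act_map G (f ⊗₁ g) h.
Proof.
unfold act_map. rewrite fmap_comp, comp_assoc, <- psi_nat.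
rewrite <- !comp_assoc. f_equal. rewrite comp_assoc. apply psi_nat_exp.
Qed.

Definition semidirect_tens (X C : skew_monoidal) (G : weak_action X C) :
  functor (prod_cat (prod_cat X C) (prod_cat X C)) (prod_cat X C).
Proof.
refine (@Functor (prod_cat (prod_cat X C) (prod_cat X C)) (prod_cat X C)
  (fun PQ => (fst (fst PQ) ⊗ fst (snd PQ),
              G (fst (snd PQ)) (snd (fst PQ)) ⊗ snd (snd PQ)))
  (fun PQ PQ' fg =>
    (fst (fst fg) ⊗₁ fst (snd fg),
     act_map G (fst (snd fg)) (snd (fst fg)) ⊗₁ snd (snd fg))) _ _).
- intros PQ. apply pair_eq; simpl.
  + apply tens_hom_id.
  + now rewrite act_map_id, tens_hom_id.
- intros PQ PQ' PQ'' g f. apply pair_eq; simpl.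
  + apply tens_hom_comp.
  + now rewrite act_map_comp, tens_hom_comp.
Defined.

Definition semidirect_alpha (X C : skew_monoidal) (G : weak_action X C)
    (y z : X) (a b c : C) :
    hom (G (y ⊗ z) a ⊗ (G z b ⊗ c)) (G z (G y a ⊗ b) ⊗ c) :=
  (phi G z (G y a) b ⊗₁ idm c) ∘ alpha (G z (G y a)) (G z b) c
    ∘ (psi G y z a ⊗₁ idm (G z b ⊗ c)).

Definition semidirect_lambda (X C : skew_monoidal) (G : weak_action X C)
    (x : X) (c : C) : hom c (G x unit ⊗ c) :=
  (phi0 G x ⊗₁ idm c) ∘ lambda c.

Definition semidirect_rho (X C : skew_monoidal) (G : weak_action X C)
    (c : C) : hom (G unit c ⊗ unit) c :=
  rho c ∘ (psi0 G c ⊗₁ idm unit).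

Definition semidirect (X C : skew_monoidal) (G : weak_action X C) : skew_data.
Proof.
refine (@SkewData (prod_cat X C) (semidirect_tens G) (unit, unit)
  (fun P Q R => (alpha (fst P) (fst Q) (fst R),
     semidirect_alpha G (fst Q) (fst R) (snd P) (snd Q) (snd R)))
  (fun P => (lambda (fst P), semidirect_lambda G (fst P) (snd P)))
  (fun P => (rho (fst P), semidirect_rho G (snd P))) _ _ _).
- intros P Q R P' Q' R' f g h. apply pair_eq; simpl.
  + apply alpha_nat.
  + unfold semidirect_alpha. rewrite !comp_assoc, <- tens_hom_comp.
    rewrite act_map_phi, comp_idr.
    pattern (snd h) at 1. rewrite <- comp_idl.
    rewrite tens_hom_comp, <- !comp_assoc. f_equal.
    rewrite comp_assoc, alpha_nat, <- !comp_assoc. f_equal.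
    rewrite <- !tens_hom_comp, comp_idl, comp_idr. f_equal.
    apply act_map_psi.
- intros P P' f. apply pair_eq; simpl.
  + apply lambda_nat.
  + unfold semidirect_lambda, act_map.
    rewrite fmap_id, comp_idl, comp_assoc, <- tens_hom_comp.
    rewrite act_hom_phi0, comp_idr, <- comp_assoc, <- lambda_nat.
    now rewrite comp_assoc, <- tens_hom_comp, comp_idl, comp_idr.
- intros P P' f. apply pair_eq; simpl.
  + apply rho_nat.
  + unfold semidirect_rho, act_map.
    rewrite act_hom_id, comp_idr, comp_assoc, rho_nat, <- !comp_assoc.
    f_equal. rewrite <- !tens_hom_comp. f_equal. apply psi0_nat.
Defined.

(* Main.v *)
Require Import Defs.

(** On the [C]-components, naturality of [alpha] and [phi] moves all
    occurrences of [psi], [psi0] and [phi0] next to each other, where the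
    axioms of a weak action turn them into the corresponding triangle identity
    of [C]: the left one uses [psi_phi0] and [phi_lambda], the middle one
    [psi_lambda] and [phi_rho], the right one [psi0_phi] and [psi_rho]. *)

Section TensorCalculus.
Context {M : skew_data}.

Lemma tens_hom_comp_idl {a a' a'' b : M} (f' : hom a' a'') (f : hom a a') :
  (f' ∘ f) ⊗₁ idm b = (f' ⊗₁ idm b) ∘ (f ⊗₁ idm b).
Proof. now rewrite <- tens_hom_comp, comp_idl. Qed.

Lemma alpha_nat1 {a a' b c : M} (f : hom a a') :
  alpha a' b c ∘ (f ⊗₁ idm (b ⊗ c)) = ((f ⊗₁ idm b) ⊗₁ idm c) ∘ alpha a b c.
Proof. now rewrite alpha_nat, tens_hom_id. Qed.

End TensorCalculus.

Section Triangles.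
Context {X C : skew_monoidal} (G : weak_action X C).

Lemma phi_nat1 (x : X) {b b' c : C} (g : hom b b') :
  fmap (G x) (g ⊗₁ idm c) ∘ phi G x b c
  = phi G x b' c ∘ (fmap (G x) g ⊗₁ idm (G x c)).
Proof. now rewrite phi_nat, fmap_id. Qed.

Lemma act_map_idl (x : X) {b b' : C} (h : hom b b') :
  act_map G (idm x) h = fmap (G x) h.
Proof. unfold act_map. now rewrite act_hom_id, comp_idr. Qed.

Lemma act_map_idr {x y : X} (f : hom x y) (b : C) :
  act_map G f (idm b) = act_hom G f b.
Proof. unfold act_map. now rewrite fmap_id, comp_idl. Qed.

Lemma semidirect_triangle_l (x y : X) (a b : C) :
  semidirect_alpha G x y unit a b ∘ semidirect_lambda G (x ⊗ y) (G y a ⊗ b)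
  = act_map G (idm y) (semidirect_lambda G x a) ⊗₁ idm b.
Proof.
unfold semidirect_alpha, semidirect_lambda.
rewrite act_map_idl, <- !comp_assoc, (comp_assoc (psi _ _ _ _ ⊗₁ _)).
rewrite <- tens_hom_comp_idl, psi_phi0, (comp_assoc (alpha _ _ _)), alpha_nat1.
rewrite <- (comp_assoc _ (alpha _ _ _)), (triangle_l (skew_axioms_of C)).
(* Both sides are now whiskered by [b], which can be stripped. *)
rewrite <- !tens_hom_comp_idl. f_equal.
(* Pulling [phi0 x] out through [phi] leaves the left side of [phi_lambda] at [y]. *)
rewrite tens_hom_comp_idl, <- comp_assoc, comp_assoc, <- phi_nat1.
rewrite fmap_comp, <- phi_lambda. now rewrite !comp_assoc.
Qed.

(** The exponent [lambda y] is the [X]-component of [lambda Q], acting on the [C]-component [a] of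
    [P]. *)
Lemma semidirect_triangle_m (y : X) (a b : C) :
  (act_map G (idm y) (semidirect_rho G a) ⊗₁ idm b)
    ∘ semidirect_alpha G unit y a unit b
    ∘ (act_map G (lambda y) (idm a) ⊗₁ semidirect_lambda G y b)
  = idm (G y a ⊗ b).
Proof.
unfold semidirect_alpha, semidirect_lambda, semidirect_rho.
rewrite act_map_idl, act_map_idr, !comp_assoc, <- tens_hom_comp_idl.
rewrite fmap_comp, <- (comp_assoc _ _ (phi _ _ _ _)), phi_nat1, !comp_assoc.
rewrite tens_hom_comp_idl.
(* [psi0] passes [alpha] to meet [psi] and [lambda y], where [psi_lambda] cancels all three. *)
rewrite <- (comp_assoc _ _ (alpha _ _ _)), <- alpha_nat1.
rewrite <- !comp_assoc, <- !tens_hom_comp, !comp_idl.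
rewrite (comp_assoc _ (psi _ _ _ _)), psi_lambda.
(* Doubling the identity separates [phi0] from [lambda b], so that [phi0] alone can pass [alpha]. *)
rewrite <- (comp_idl (idm (G y a))), tens_hom_comp.
rewrite (comp_assoc (alpha _ _ _)), <- alpha_nat, !comp_assoc.
rewrite <- tens_hom_comp_idl, phi_rho.
apply (triangle_m (skew_axioms_of C)).
Qed.

Lemma semidirect_triangle_r (y : X) (a b : C) :
  semidirect_rho G (G y a ⊗ b) ∘ semidirect_alpha G y unit a b unit
  = act_map G (rho y) (idm a) ⊗₁ semidirect_rho G b.
Proof.
unfold semidirect_alpha, semidirect_rho.
rewrite act_map_idr, !comp_assoc.
(* Of the two resulting copies of [psi0], one will meet [psi], the other belongs to
   [semidirect_rho G b]. *)
rewrite <- (comp_assoc (rho _)), <- tens_hom_comp_idl, psi0_phi.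
rewrite <- (comp_assoc (rho _)), alpha_nat, comp_assoc.
rewrite (triangle_r (skew_axioms_of C)), <- !tens_hom_comp.
now rewrite comp_idl, comp_idr, psi_rho.
Qed.

End Triangles.

Theorem lemma4p3 (X C : skew_monoidal) (G : weak_action X C) :
  forall P Q : semidirect G,
    alpha unit P Q ∘ lambda (P ⊗ Q) = lambda P ⊗₁ idm Q
    /\ (rho P ⊗₁ idm Q) ∘ alpha P unit Q ∘ (idm P ⊗₁ lambda Q) = idm (P ⊗ Q)
    /\ rho (P ⊗ Q) ∘ alpha P Q unit = idm P ⊗₁ rho Q.
Proof.
(* The [X]-components are the triangles of [X]; the [C]-components match the lemmas above by
   conversion. *)
intros [x a] [y b]; repeat split; apply pair_eq.
- apply (triangle_l (skew_axioms_of X)).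
- apply semidirect_triangle_l.
- apply (triangle_m (skew_axioms_of X)).
- apply semidirect_triangle_m.
- apply (triangle_r (skew_axioms_of X)).
- apply semidirect_triangle_r.
Qed.
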